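(* Assume $\mathrm{Var}(\mathbf{x}_\ast)=\sigma_x^2\mathbf{I}_d$ for some $\sigma_x>0$. Let $\mathcal{S}_1\subset\mathcal{S}_2\subseteq\mathcal{D}=\{1,\dots,d\}$ with $|\mathcal{S}_1|\ge n$, and suppose that $\mathbf{X}_{\mathcal{S}_1}$ has full row rank. Then $$\mathrm{df}_{\rm R}(\mathcal{S}_2)\le\mathrm{df}_{\rm R}(\mathcal{S}_1).$$ In particular, if there exists $j\in\mathcal{S}_2\setminus\mathcal{S}_1$ such that $\mathbf{x}_{(j)}$ is not in the null space of $(\mathbf{X}_{\mathcal{S}_1}\mathbf{X}_{\mathcal{S}_1}^\top)^{-1}$, then the inequality holds strictly.
   Context: Let $\mathbf{X}\in\mathbb{R}^{n\times d}$ be a design matrix whose rows $\mathbf{x}_i^\top$ are i.i.d. with mean $\mathbf{0}$ and covariance matrix $\boldsymbol\Sigma\in\mathbb{R}^{d\times d}$, and let the test point $\mathbf{x}_\ast$ be an independent copy of $\mathbf{x}_i$ (so $\mathrm{Var}(\mathbf{x}_\ast)=\boldsymbol\Sigma$). $\mathbf{x}_{(j)}\in\mathbb{R}^n$ denotes the $j$th column of $\mathbf{X}$. For $\mathcal{S}\subseteq\{1,\dots,d\}$ with $|\mathcal{S}|=p$, $\mathbf{X}_{\mathcal{S}}\in\mathbb{R}^{n\times p}$ is the submatrix of the columns of $\mathbf{X}$ indexed by $\mathcal{S}$ and $\boldsymbol\Sigma_{\mathcal{S}}$ is the corresponding principal submatrix of $\boldsymbol\Sigma$. The predictive model degrees of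 freedom (given $\mathbf{X}$) of the least squares regression on the variables in $\mathcal{S}$ (ordinary least squares with $\mathbf{X}_{\mathcal S}$ of full column rank if $p\le n$; minimum-$\ell_2$-norm least squares with $\mathbf{X}_{\mathcal S}$ of full row rank if $p>n$) is $$\mathrm{df}_{\rm R}(\mathcal{S})=\begin{cases}\dfrac p2+\dfrac n2\,\mathrm{tr}\big[(\mathbf{X}_{\mathcal{S}}^\top\mathbf{X}_{\mathcal{S}})^{-1}\boldsymbol\Sigma_{\mathcal{S}}\big],&p\le n,\\[2mm]\dfrac n2+\dfrac n2\,\mathrm{tr}\big[\mathbf{X}_{\mathcal{S}}^\top(\mathbf{X}_{\mathcal{S}}\mathbf{X}_{\mathcal{S}}^\top)^{-2}\mathbf{X}_{\mathcal{S}}\boldsymbol\Sigma_{\mathcal{S}}\big],&p>n.\end{cases}$$ *)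

(* Defs.v *)
From HB Require Import structures.
From mathcomp Require Import all_boot all_order all_algebra.
From mathcomp Require Import all_classical all_reals all_analysis.

Set Implicit Arguments.
Unset Strict Implicit.
Unset Printing Implicit Defensive.

Import Order.TTheory GRing.Theory Num.Theory.

Local Open Scope classical_set_scope.
Local Open Scope ring_scope.

(* A random vector of R^d is a random variable with values in d.-tuple R,
   which carries the product sigma-algebra. *)

(* For a finite family, the product rule on the whole index type gives the
   product rule on every subfamily, by taking B i = setT outside of it. *)
Definition mutually_independent dO (Omega : measurableType dO) (R : realType)
    (P : probability Omega R) dT (T : measurableType dT) (I : finType)
    (Y : I -> {RV P >-> T}) : Prop :=
  forall B : I -> set T, (forall i, measurable (B i)) ->
    P (\bigcap_(i in [set: I]) (Y i @^-1` B i)) =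
    (\prod_(i : I) fine (P (Y i @^-1` B i)))%:E.

Definition identically_distributed dO (Omega : measurableType dO)
    (R : realType) (P : probability Omega R) dT (T : measurableType dT)
    (I : finType) (Y : I -> {RV P >-> T}) : Prop :=
  forall (i k : I) (B : set T), measurable B ->
    distribution P (Y i) B = distribution P (Y k) B.

(* The sample x_1, ..., x_n together with the test point, indexed by None. *)
Definition with_test_point dO (Omega : measurableType dO) (R : realType)
    (P : probability Omega R) n d (x : 'I_n -> {RV P >-> d.-tuple R})
    (xstar : {RV P >-> d.-tuple R}) : option 'I_n -> {RV P >-> d.-tuple R} :=
  fun o => if o is Some i then x i else xstar.

Definition coordinate dO (Omega : measurableType dO) (R : realType) d
    (Y : Omega -> d.-tuple R) (j : 'I_d) : Omega -> R :=
  fun w => tnth (Y w) j.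

Definition centered dO (Omega : measurableType dO) (R : realType)
    (P : probability Omega R) d (Y : {RV P >-> d.-tuple R}) : Prop :=
  forall j : 'I_d, ('E_P[coordinate Y j] = 0)%E.

Definition has_covariance_matrix dO (Omega : measurableType dO) (R : realType)
    (P : probability Omega R) d (Y : {RV P >-> d.-tuple R})
    (Sigma : 'M[R]_d) : Prop :=
  (forall j : 'I_d, coordinate Y j \in Lfun P 2%:E) /\
  (forall j k : 'I_d,
     covariance P (coordinate Y j) (coordinate Y k) = (Sigma j k)%:E).

Definition design_matrix dO (Omega : measurableType dO) (R : realType)
    (P : probability Omega R) n d (x : 'I_n -> {RV P >-> d.-tuple R})
    (w : Omega) : 'M[R]_(n, d) :=
  \matrix_(i, j) tnth (x i w) j.

Definition col_submx (R : Type) n d (S : {set 'I_d}) (X : 'M[R]_(n, d)) :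
    'M[R]_(n, #|S|) :=
  colsub (fun k : 'I_#|S| => enum_val k) X.

Definition principal_submx (R : Type) d (S : {set 'I_d}) (M : 'M[R]_d) :
    'M[R]_#|S| :=
  mxsub (fun k : 'I_#|S| => enum_val k) (fun k : 'I_#|S| => enum_val k) M.

(* Meaningful when X_S has full column rank (#|S| <= n) or full row rank
   (n < #|S|), since invmx is the identity on singular matrices. *)
Definition df_R (R : realType) n d (X : 'M[R]_(n, d)) (Sigma : 'M[R]_d)
    (S : {set 'I_d}) : R :=
  let XS := col_submx S X in
  let SigmaS := principal_submx S Sigma in
  if (#|S| <= n)%N then
    #|S|%:R / 2 + n%:R / 2 * \tr (invmx (XS^T *m XS) *m SigmaS)
  else
    let Ginv := invmx (XS *m XS^T) in
    n%:R / 2 + n%:R / 2 * \tr (XS^T *m (Ginv *m Ginv) *m XS *m SigmaS).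

(* Main.v *)
(** With Sigma = s^2 I, the degrees of freedom of a full row rank X_S equal
    n/2 + (n/2) s^2 tr (G_S^-1), where G_S = X_S X_S^T is the sum of the x_j x_j^T
    over j in S.  If G2 = G1 + D then
    G1^-1 - G2^-1 = G2^-1 D G2^-1 + G2^-1 D G1^-1 D G2^-1,
    where both terms are positive semidefinite; the trace of the first one is
    the sum of the |G2^-1 x_j|^2 over j in S2 \ S1, which is positive as soon
    as one of these x_j is nonzero. *)

Require Import Defs.
From HB Require Import structures.
From mathcomp Require Import all_boot all_order all_algebra.
From mathcomp Require Import all_classical all_reals all_analysis.
Import Order.TTheory GRing.Theory Num.Theory.
Local Open Scope ring_scope.

Set Implicit Arguments.
Unset Strict Implicit.
Unset Printing Implicit Defensive.

(** This is the squared Frobenius norm of [A], through which positivity of traces enters. *)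
Lemma mxtrace_mulmx_tr (R : comPzRingType) (m n : nat) (A : 'M[R]_(m, n)) :
  \tr (A *m A^T) = \sum_i \sum_j A i j ^+ 2.
Proof.
apply: eq_bigr => i _; rewrite !mxE; apply: eq_bigr => j _.
by rewrite !mxE expr2.
Qed.

Lemma mxtrace_mulmx_tr_ge0 (R : realDomainType) (m n : nat) (A : 'M[R]_(m, n)) :
  0 <= \tr (A *m A^T).
Proof.
by rewrite mxtrace_mulmx_tr; do 2!apply: sumr_ge0 => ? _; rewrite sqr_ge0.
Qed.

Lemma mxtrace_mulmx_tr_eq0 (R : realDomainType) (m n : nat) (A : 'M[R]_(m, n)) :
  (\tr (A *m A^T) == 0) = (A == 0).
Proof.
apply/idP/eqP => [|->]; last by rewrite mul0mx mxtrace0.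
have ge0 i : 0 <= \sum_j A i j ^+ 2 by apply: sumr_ge0 => j _; rewrite sqr_ge0.
rewrite mxtrace_mulmx_tr psumr_eq0 => [/allP A0|i _]; last exact: ge0.
apply/matrixP => i j; rewrite mxE; apply/eqP; rewrite -sqrf_eq0.
have := A0 i (mem_index_enum _); rewrite /= psumr_eq0; last first.
  by move=> k _; rewrite sqr_ge0.
by move=> /allP/(_ j (mem_index_enum _)).
Qed.

(** If [K] kills [A *m A^T] on the left, then [K *m A] has squared Frobenius norm 0, hence vanishes,
    and row freeness of [A] gives [K = 0]. *)
Lemma gram_unitmx (R : realFieldType) (m n : nat) (A : 'M[R]_(n, m)) :
  row_free A -> A *m A^T \in unitmx.
Proof.
move=> freeA; rewrite -row_free_unit -kermx_eq0.
set K := kermx _; have KG0 : K *m (A *m A^T) = 0 by exact: mulmx_ker.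
have : K *m A == 0.
  by rewrite -mxtrace_mulmx_tr_eq0 trmx_mul mulmxA -(mulmxA K) KG0 mul0mx mxtrace0.
by rewrite mulmx_free_eq0.
Qed.

Lemma trmx_gram (R : comPzRingType) (m n : nat) (A : 'M[R]_(n, m)) :
  (A *m A^T)^T = A *m A^T.
Proof. by rewrite trmx_mul trmxK. Qed.

Lemma invmx_mulmx (R : comUnitRingType) (n : nat) (A B : 'M[R]_n) :
  A \in unitmx -> B \in unitmx -> invmx (A *m B) = invmx B *m invmx A.
Proof.
move=> uA uB; have uAB : A *m B \in unitmx by rewrite unitmx_mul uA.
apply: (can_inj (mulKmx uAB)).
by rewrite mulmxV // mulmxA mulmxK // mulmxV.
Qed.

(** The hypotheses force [m = n], so [A] is invertible and the two inverses are the same two factors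
    in opposite order. This serves the boundary case [#|S| = n] of [df_R]. *)
Lemma mxtrace_invmx_gramC (R : fieldType) (m n : nat) (A : 'M[R]_(n, m)) :
  row_free A -> (m <= n)%N ->
  \tr (invmx (A^T *m A)) = \tr (invmx (A *m A^T)).
Proof.
move=> freeA le_mn.
have eq_mn : m = n.
  by apply/eqP; rewrite eqn_leq le_mn -(eqP freeA) rank_leq_col.
case: n / eq_mn A freeA {le_mn} => A; rewrite row_free_unit => unitA.
have unitAT : A^T \in unitmx by rewrite unitmx_tr.
by rewrite !invmx_mulmx // mxtrace_mulC.
Qed.

(** The resolvent identity applied twice, once on each side, so that both terms are symmetric
    sandwiches when [A] and [B] are symmetric. *)
Lemma invmx_sub_expand (R : comUnitRingType) (n : nat) (A B : 'M[R]_n) :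
  A \in unitmx -> B \in unitmx ->
  invmx A - invmx B =
  invmx B *m (B - A) *m invmx B +
  invmx B *m (B - A) *m invmx A *m (B - A) *m invmx B.
Proof.
move=> uA uB.
have resolventl : invmx A = invmx B + invmx A *m (B - A) *m invmx B.
  by rewrite mulmxBr mulmxBl mulmxK // mulVmx // mul1mx addrC subrK.
have resolventr : invmx A - invmx B = invmx B *m (B - A) *m invmx A.
  by rewrite mulmxBr mulmxBl mulVmx // mul1mx mulmxK.
by rewrite resolventr {1}resolventl mulmxDr !mulmxA.
Qed.

Lemma gram_col_submx (R : comPzRingType) (n d : nat) (S : {set 'I_d})
    (X : 'M[R]_(n, d)) :
  col_submx S X *m (col_submx S X)^T =
  \sum_(j in S) col j X *m (col j X)^T.
Proof.
apply/matrixP => i k; rewrite summxE mxE.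
rewrite (eq_bigr (fun j => X i j * X k j)); last first.
  by move=> j _; rewrite !mxE big_ord1 !mxE.
by rewrite [RHS]big_enum_val; apply: eq_bigr => j _; rewrite !mxE.
Qed.

Lemma gram_col_submxD (R : comPzRingType) (n d : nat) (S1 S2 : {set 'I_d})
    (X : 'M[R]_(n, d)) : S1 \subset S2 ->
  col_submx S2 X *m (col_submx S2 X)^T - col_submx S1 X *m (col_submx S1 X)^T =
  col_submx (S2 :\: S1) X *m (col_submx (S2 :\: S1) X)^T.
Proof.
move=> S12; rewrite !gram_col_submx (big_setID S1) /= (finset.setIidPr S12).
by rewrite addrAC subrr add0r.
Qed.

(** The columns indexed by [S1] occur among those indexed by [S2], so the left kernel can only
    shrink. *)
Lemma row_free_col_submxS (R : fieldType) (n d : nat) (S1 S2 : {set 'I_d})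
    (X : 'M[R]_(n, d)) : S1 \subset S2 ->
  row_free (col_submx S1 X) -> row_free (col_submx S2 X).
Proof.
move=> /fintype.subsetP S12 free1; rewrite -kermx_eq0; set K := kermx _.
have K0 : K *m col_submx S2 X = 0 by exact: mulmx_ker.
rewrite -(mulmx_free_eq0 _ free1); apply/eqP/matrixP => i k.
have S2k := S12 _ (enum_valP k).
move/matrixP: K0 => /(_ i (enum_rank_in S2k (enum_val k))); rewrite !mxE => K0.
by rewrite -[RHS]K0; apply: eq_bigr => l _; rewrite !mxE enum_rankK_in.
Qed.

Lemma principal_submx_scalar (R : pzRingType) (d : nat) (S : {set 'I_d}) (a : R) :
  principal_submx S a%:M = a%:M.
Proof. by apply/matrixP => i j; rewrite !mxE (inj_eq enum_val_inj). Qed.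

Lemma df_R_isotropic (R : realType) (n d : nat) (X : 'M[R]_(n, d)) (a : R)
    (S : {set 'I_d}) : row_free (col_submx S X) ->
  df_R X a%:M S = n%:R / 2 +
    n%:R / 2 * (a * \tr (invmx (col_submx S X *m (col_submx S X)^T))).
Proof.
move=> freeS; rewrite /df_R principal_submx_scalar !mul_mx_scalar !linearZ /=.
have le_nS : (n <= #|S|)%N by rewrite -{1}(eqP freeS) rank_leq_col.
(* Full row rank leaves only [#|S| = n] for the first branch, where the matrix is square. In the
   second, cyclicity of the trace cancels the Gram matrix against one of its two inverses. *)
case: leqP => [le_Sn|_].
  have eq_Sn : #|S| = n by apply/eqP; rewrite eqn_leq le_Sn.
  by rewrite mxtrace_invmx_gramC // [X in X%:R / 2 + _]eq_Sn.
by rewrite mxtrace_mulC !mulmxA mulmxV ?mul1mx // gram_unitmx.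
Qed.

Section NestedGram.
Variables (R : realFieldType) (n d : nat) (X : 'M[R]_(n, d)).
Variables (S1 S2 : {set 'I_d}).
Hypotheses (S12 : S1 \subset S2) (free1 : row_free (col_submx S1 X)).

Let A := col_submx S1 X.
Let B := col_submx (S2 :\: S1) X.
Let G1 := A *m A^T.
Let G2 := col_submx S2 X *m (col_submx S2 X)^T.

Let unitG1 : G1 \in unitmx. Proof. exact: gram_unitmx. Qed.

Let unitG2 : G2 \in unitmx.
Proof. exact/gram_unitmx/(row_free_col_submxS _ free1). Qed.

Let trG1V : (invmx G1)^T = invmx G1.
Proof. by rewrite trmx_inv trmx_gram. Qed.

Let trG2V : (invmx G2)^T = invmx G2.
Proof. by rewrite trmx_inv trmx_gram. Qed.

Lemma mxtrace_invmx_gram_ge :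
  \tr (invmx G2 *m B *m (invmx G2 *m B)^T) <= \tr (invmx G1) - \tr (invmx G2).
Proof.
rewrite -raddfB invmx_sub_expand // gram_col_submxD // -/B raddfD /=.
rewrite trmx_mul trG2V !mulmxA lerDl.
(* Writing the inner [invmx G1] as [invmx G1 *m A *m A^T *m invmx G1] exhibits the second-order term
   as some [M *m M^T]. *)
have -> : invmx G2 *m B *m B^T *m invmx G1 *m B *m B^T *m invmx G2 =
    (invmx G2 *m B *m B^T *m invmx G1 *m A) *m
    (invmx G2 *m B *m B^T *m invmx G1 *m A)^T.
  rewrite !trmx_mul trG1V trG2V trmxK !mulmxA.
  by rewrite -(mulmxA _ A A^T) mulmxKV.
exact: mxtrace_mulmx_tr_ge0.
Qed.

Lemma le_mxtrace_invmx_gram : \tr (invmx G2) <= \tr (invmx G1).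
Proof.
by rewrite -subr_ge0 (le_trans _ mxtrace_invmx_gram_ge) // mxtrace_mulmx_tr_ge0.
Qed.

(** Without a strict decrease, the lower bound on the gap forces [invmx G2 *m B = 0], hence [B = 0],
    so every added column vanishes. *)
Lemma lt_mxtrace_invmx_gram (j : 'I_d) : j \in S2 :\: S1 -> col j X != 0 ->
  \tr (invmx G2) < \tr (invmx G1).
Proof.
move=> Dj; rewrite ltNge; apply: contra => le12; apply/eqP.
have : invmx G2 *m B == 0.
  rewrite -mxtrace_mulmx_tr_eq0 eq_le mxtrace_mulmx_tr_ge0 andbT.
  by rewrite (le_trans mxtrace_invmx_gram_ge) // subr_le0.
move=> /eqP/(congr1 (mulmx G2)); rewrite mulKVmx // mulmx0 => B0.
apply/matrixP => i k; rewrite !mxE.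
move/matrixP: B0 => /(_ i (enum_rank_in Dj j)).
by rewrite !mxE enum_rankK_in.
Qed.

End NestedGram.

Theorem theorem4p4 (R : realType) (dO : measure_display)
    (Omega : measurableType dO) (P : probability Omega R) (n d : nat)
    (x : 'I_n -> {RV P >-> d.-tuple R}) (xstar : {RV P >-> d.-tuple R})
    (Sigma : 'M[R]_d)
    (x_indep : mutually_independent (with_test_point x xstar))
    (x_ident : identically_distributed (with_test_point x xstar))
    (x_mean : forall o : option 'I_n, centered (with_test_point x xstar o))
    (x_cov : forall o : option 'I_n,
       has_covariance_matrix (with_test_point x xstar o) Sigma)
    (sigma_x : R) (sigma_x_gt0 : 0 < sigma_x)
    (Sigma_iso : Sigma = (sigma_x ^+ 2)%:M)
    (S1 S2 : {set 'I_d}) (S1S2 : S1 \subset S2) (n_le_S1 : (n <= #|S1|)%N)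
    (w : Omega)
    (XS1_full : row_free (col_submx S1 (design_matrix x w))) :
  let X := design_matrix x w in
  let XS1 := col_submx S1 X in
  df_R X Sigma S2 <= df_R X Sigma S1 /\
  ((exists2 j : 'I_d, j \in S2 :\: S1 &
      invmx (XS1 *m XS1^T) *m col j X <> 0) ->
   df_R X Sigma S2 < df_R X Sigma S1).
Proof.
move=> X XS1; have free2 := row_free_col_submxS S1S2 XS1_full.
have s2_gt0 : 0 < sigma_x ^+ 2 by rewrite exprn_gt0.
rewrite Sigma_iso !df_R_isotropic //; split=> [|[j Dj xj0]].
  rewrite lerD2l ler_wpM2l ?divr_ge0 ?ler0n // ler_pM2l //.
  exact: le_mxtrace_invmx_gram.
have xj_neq0 : col j X != 0 by apply: contra_not_neq xj0 => ->; rewrite mulmx0.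
(* Strictness survives multiplication by n/2 only if n is positive; a nonzero entry of the column
   provides an element of ['I_n]. *)
have n_gt0 : (0 < n)%N.
  have [i _|] := pickP (fun i => col j X i 0 != 0).
    exact: leq_ltn_trans (ltn_ord i).
  move=> col0; case/eqP: xj_neq0; apply/matrixP => i k.
  by rewrite [k]ord1 [RHS]mxE; apply/eqP/negbFE/col0.
rewrite ltrD2l ltr_pM2l ?divr_gt0 ?ltr0n // ltr_pM2l //.
exact: (lt_mxtrace_invmx_gram _ _ Dj).
Qed.
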